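(* There exist absolute constants $C_1, C_2>0$ such that the following holds. Let $N\ge 2$, $s>R\ge 1$, $n\ge 1$ be integers and let $\epsilon,\delta\in(0,1)$. Let $\mathbf{P}=\mathbf{A}^{(1)}\otimes\mathbf{A}^{(2)}\otimes\cdots\otimes\mathbf{A}^{(N-1)}\in\mathbb{R}^{s^{N-1}\times R^{N-1}}$ (Kronecker product), where each $\mathbf{A}^{(i)}\in\mathbb{R}^{s\times R}$ has orthonormal columns, and let $\mathbf{B}\in\mathbb{R}^{s^{N-1}\times n}$. Let $\mathbf{S}\in\mathbb{R}^{m\times s^{N-1}}$ be an order $N-1$ TensorSketch matrix with $$m \ge C_1\,\frac{R^{N-1}\cdot 3^{N-1}}{\delta}\left(R^{N-1}+\frac{1}{\epsilon^2}\right).$$ Let $\widetilde{\mathbf{X}}_{\mathrm{r}}$ be the best rank-$R$ approximation of the solution of the unconstrained problem $\min_{\mathbf{X}\in\mathbb{R}^{R^{N-1}\times n}}\|\mathbf{S}\mathbf{P}\mathbf{X}-\mathbf{S}\mathbf{B}\|_F$, and let $\mathbf{X}_{\mathrm{r}}\in\arg\min_{\mathbf{X},\ \mathrm{rank}(\mathbf{X})\le R}\|\mathbf{P}\mathbf{X}-\mathbf{B}\|_F$. Then $$\|\mathbf{P}\widetilde{\mathbf{X}}_{\mathrm{r}}-\mathbf{B}\|_F^2\le (1+C_2\,\epsilon)\,\|\mathbf{P}\mathbf{X}_{\mathrm{r}}-\mathbf{B}\|_F^2$$ holds with probability at least $1-\delta$ (over the random choice of $\mathbf{S}$).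
   Context: $\|\cdot\|_F$ is the Frobenius norm. A best rank-$R$ approximation of a matrix $\mathbf{X}$ is a minimizer of $\|\mathbf{X}-\mathbf{Y}\|_F$ over matrices $\mathbf{Y}$ of rank at most $R$. TensorSketch: an order $K$ TensorSketch matrix $\mathbf{S}=\mathbf{\Omega}\mathbf{D}\in\mathbb{R}^{m\times\prod_{k=1}^K s_k}$ is the random matrix defined as follows. For each $k\in\{1,\dots,K\}$ let $H_k:\{1,\dots,s_k\}\to\{1,\dots,m\}$ be a random 3-wise independent hash map with uniformly distributed values, and $S_k:\{1,\dots,s_k\}\to\{-1,1\}$ a random 4-wise independent hash map with uniformly distributed values, all these hash maps being mutually independent. (A hash map is $k$-wise independent if its values at any $k$ distinct keys are independent random variables.) Define $$H(i_1,\dots,i_K)=\Big(\sum_{k=1}^K (H_k(i_k)-1) \bmod m\Big)+1,\qquad S(i_1,\dots,i_K)=\prod_{k=1}^K S_k(i_k),$$ and identify the multi-index $(i_1,\dots,i_K)$ with the single index $i=i_1+\sum_{k=2}^K\big(\prod_{\ell=1}^{k-1}s_\ell\big)(i_k-1)$. Then $\mathbf{\Omega}(j,i)=1$ if $j=H(i)$ and $0$ otherwise, and $\mathbf{D}$ is the diagonal matrix with $\mathbf{D}(i,i)=S(i)$. Here $K=N-1$ and all $s_k=s$. The constants $C_1,C_2$ spell out the asymptotic notation: a sketch size $m=\mathcal{O}(\cdot)$ of the stated form suffices for relative error $1+\mathcal{O}(\epsilon)$. *)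

(* Defs.v *)
From mathcomp Require Import all_boot all_order all_algebra.
From mathcomp Require character.
From mathcomp Require Import all_classical all_reals all_analysis.

Set Implicit Arguments.
Unset Strict Implicit.
Unset Printing Implicit Defensive.

Import Order.TTheory GRing.Theory Num.Theory.
Import numFieldNormedType.Exports.
Local Open Scope classical_set_scope.
Local Open Scope ring_scope.

Section Matrices.
Variable R : realType.

Definition frob m n (A : 'M[R]_(m, n)) : R :=
  Num.sqrt (\sum_i \sum_j A i j ^+ 2).

Definition best_rank_approx m n (r : nat) (X Y : 'M[R]_(m, n)) : Prop :=
  (\rank Y <= r)%N /\
  forall Z : 'M[R]_(m, n), (\rank Z <= r)%N -> frob (X - Y) <= frob (X - Z).

Definition lsq_solution m p n (M : 'M[R]_(m, p)) (B : 'M[R]_(m, n))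
    (X : 'M[R]_(p, n)) : Prop :=
  forall Y : 'M[R]_(p, n), frob (M *m X - B) <= frob (M *m Y - B).

Definition rank_lsq_solution m p n (r : nat) (M : 'M[R]_(m, p))
    (B : 'M[R]_(m, n)) (X : 'M[R]_(p, n)) : Prop :=
  (\rank X <= r)%N /\
  forall Y : 'M[R]_(p, n), (\rank Y <= r)%N ->
    frob (M *m X - B) <= frob (M *m Y - B).

(* [character.tprod A B] is the binary Kronecker product, the block matrix
   with blocks [A i j *: B]; thus [kron A] is
   A_0 ⊗ (A_1 ⊗ ( ... ⊗ A_(K-1))). *)
Fixpoint kron s r K : ('I_K -> 'M[R]_(s, r)) -> 'M[R]_(s ^ K, r ^ K) :=
  match K with
  | 0 => fun _ => 1%:M
  | K'.+1 => fun A =>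
      castmx (esym (expnS s K'), esym (expnS r K'))
        (character.tprod (A ord0) (kron (fun k => A (lift ord0 k))))
  end.

End Matrices.

Section MultiIndex.
Variables s K : nat.

Lemma digit_subproof (i : 'I_(s ^ K)) (k : 'I_K) : (i %/ s ^ k %% s < s)%N.
Proof.
rewrite ltn_mod; case: s i => // -[i]; rewrite exp0n //.
by case: K k => [[]|].
Qed.

(* The [k]-th entry of the multi-index identified with [i], where the first
   entry varies fastest (see [digitE]); all indices start at 0. *)
Definition digit (i : 'I_(s ^ K)) (k : 'I_K) : 'I_s :=
  Ordinal (digit_subproof i k).

Lemma digitE (i : 'I_(s ^ K)) :
  (i : nat) = (\sum_(k < K) s ^ k * digit i k)%N.
Proof.
have H n L : (n = \sum_(k < L) s ^ k * (n %/ s ^ k %% s) + s ^ L * (n %/ s ^ L))%N.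
  elim: L => [|L IH]; first by rewrite big_ord0 expn0 divn1 mul1n.
  rewrite big_ord_recr /= {1}IH -addnA; congr addn.
  rewrite expnSr divnMA -mulnA -mulnDr; congr muln.
  by rewrite addnC mulnC -divn_eq.
by rewrite {1}(H i K) /= divn_small // muln0 addn0.
Qed.

End MultiIndex.

Section TensorSketch.
Variables (R : realType) (K s m : nat).
Variables (h : 'I_K -> {ffun 'I_s -> 'I_m}) (g : 'I_K -> {ffun 'I_s -> bool}).

Definition ts_bucket (i : 'I_(s ^ K)) : nat :=
  ((\sum_(k < K) h k (digit i k)) %% m)%N.

(* The sign hash maps are coded by booleans: [b] stands for (-1)^b. *)
Definition ts_sign (i : 'I_(s ^ K)) : R := \prod_(k < K) (-1) ^+ g k (digit i k).

Definition ts_Omega : 'M[R]_(m, s ^ K) :=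
  \matrix_(j < m, i < s ^ K) ((j : nat) == ts_bucket i)%:R.

Definition ts_D : 'M[R]_(s ^ K) := diag_mx (\row_i ts_sign i).

Definition ts_matrix : 'M[R]_(m, s ^ K) := ts_Omega *m ts_D.

End TensorSketch.

Section Randomness.
Variables (R : realType) (d : measure_display) (T : measurableType d).
Variable Pr : probability T R.

(* Independence of the subfamily of discrete random variables indexed by [J]:
   since [A i] may be the full set, the product rule for [J] contains the
   product rule for every subset of [J]. *)
Definition independent_on (I : finType) (J : {set I}) (E : I -> Type)
    (X : forall i, T -> E i) : Prop :=
  forall A : forall i, set (E i),
    Pr [set w | forall i, i \in J -> A i (X i w)] =
    (\prod_(i in J) Pr (X i @^-1` A i))%E.

(* "At most [k]" rather than "exactly [k]" distinct keys: the two agree when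
   there are at least [k] keys, and the latter is void otherwise. *)
Definition kwise_independent (k : nat) (I V : finType)
    (h : T -> {ffun I -> V}) : Prop :=
  forall J : {set I}, (#|J| <= k)%N ->
    independent_on J (fun i w => h w i).

Definition uniform_values (I V : finType) (h : T -> {ffun I -> V}) : Prop :=
  forall i v, Pr [set w | h w i = v] = ((#|V|%:R : R)^-1)%:E.

Definition random_hash (k : nat) (I V : finType) (h : T -> {ffun I -> V}) :
    Prop :=
  [/\ forall f, measurable [set w | h w = f],
      uniform_values h & kwise_independent k h].

Definition ts_codom (K s m : nat) (j : 'I_K + 'I_K) : Type :=
  match j with
  | inl _ => {ffun 'I_s -> 'I_m}
  | inr _ => {ffun 'I_s -> bool}
  end.

Definition ts_family (K s m : nat) (H : 'I_K -> T -> {ffun 'I_s -> 'I_m})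
    (G : 'I_K -> T -> {ffun 'I_s -> bool}) (j : 'I_K + 'I_K) :
    T -> ts_codom s m j :=
  match j return T -> ts_codom s m j with inl k => H k | inr k => G k end.

Definition tensorsketch (K s m : nat) (S : T -> 'M[R]_(m, s ^ K)) : Prop :=
  exists (H : 'I_K -> T -> {ffun 'I_s -> 'I_m})
         (G : 'I_K -> T -> {ffun 'I_s -> bool}),
    [/\ forall k, random_hash 3 (H k),
        forall k, random_hash 4 (G k),
        independent_on [set: 'I_K + 'I_K]%SET (ts_family H G) &
        forall w, S w = ts_matrix R (H ^~ w) (G ^~ w)].

End Randomness.

(* Main.v *)
Require Import Defs.
From mathcomp Require Import all_boot all_order all_algebra.
From mathcomp Require Import all_classical all_reals all_analysis.
From mathcomp Require Import ring lra.

(* Let [P] be the Kronecker product, [X0 = P^T B], and [C = B - P X0], so that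
   [P^T C = 0]. If the sketch [M] satisfies
     |(M P)^T (M P) - 1|_F <= 1/2   and   |(M P)^T (M C)|_F <= eps |C|_F,
   then by the normal equations the sketched solution is within [2 eps |C|] of
   [X0]; two triangle inequalities show that its best rank-r approximation is at
   distance at most [|Xr - X0| + 4 eps |C|] from [X0], and Pythagoras concludes.

   Both conditions hold with the required probability by Markov's inequality
   and the second moment bound
     E |(M A)^T (M B) - A^T B|_F^2 <= 3^K / m |A|_F^2 |B|_F^2.
   In its expansion, the sign hashes kill every quadruple of multi-indices that
   is not paired off in each coordinate (three ways per coordinate), and the
   bucket hashes make each off-diagonal collision have probability [1/m]. *)

Set Implicit Arguments.
Unset Strict Implicit.
Unset Printing Implicit Defensive.

Import Order.TTheory GRing.Theory Num.Theory.
Import numFieldNormedType.Exports.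
Local Open Scope classical_set_scope.
Local Open Scope ring_scope.

(** * Cauchy-Schwarz and paired quadruple sums *)

(** Lagrange's identity: twice the gap between the two sides is the double sum of the squares
    [(a i * b j - a j * b i) ^+ 2]. *)
Lemma cauchy_schwarz_sum (R : realDomainType) (I : finType) (a b : I -> R) :
  (\sum_i a i * b i) ^+ 2 <= (\sum_i a i ^+ 2) * (\sum_i b i ^+ 2).
Proof.
rewrite -subr_ge0 -(pmulr_rge0 _ (ltr0Sn R 1)).
suff -> : 2%:R * ((\sum_i a i ^+ 2) * (\sum_i b i ^+ 2) -
    (\sum_i a i * b i) ^+ 2) = \sum_i \sum_j (a i * b j - a j * b i) ^+ 2.
  by apply: sumr_ge0 => i _; apply: sumr_ge0 => j _; exact: sqr_ge0.
have E f g : (\sum_i f i) * (\sum_j g j) = \sum_i \sum_j f i * g j :> R.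
  by rewrite mulr_suml; apply: eq_bigr => i _; rewrite mulr_sumr.
rewrite expr2 mulrBr mulr_natl mulr2n [X in _ + X - _]mulrC !E.
rewrite mulr_sumr -big_split -sumrB /=; apply: eq_bigr => i _.
rewrite mulr_sumr -big_split -sumrB /=; apply: eq_bigr => j _.
by ring.
Qed.

Definition l2norm (R : rcfType) (I : finType) (a : I -> R) : R :=
  Num.sqrt (\sum_i a i ^+ 2).

Lemma l2norm_ge0 (R : rcfType) (I : finType) (a : I -> R) : 0 <= l2norm a.
Proof. exact: sqrtr_ge0. Qed.

Lemma sqr_l2norm (R : rcfType) (I : finType) (a : I -> R) :
  l2norm a ^+ 2 = \sum_i a i ^+ 2.
Proof. by rewrite sqr_sqrtr // sumr_ge0 // => i _; exact: sqr_ge0. Qed.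

Lemma sum_mul_le_l2norm (R : rcfType) (I : finType) (a b : I -> R) :
  \sum_i a i * b i <= l2norm a * l2norm b.
Proof.
apply: le_trans (ler_norm _) _.
rewrite -(@ler_pXn2r _ 2) ?nnegrE ?mulr_ge0 ?l2norm_ge0 //.
by rewrite exprMn !sqr_l2norm real_normK ?num_real // cauchy_schwarz_sum.
Qed.

Section FunctionsOnOrdSucc.
Variables (K : nat) (X : finType).

Definition ffcons (x : X) (f : {ffun 'I_K -> X}) : {ffun 'I_K.+1 -> X} :=
  [ffun k => if unlift ord0 k is Some k' then f k' else x].

Lemma ffcons0 x f : ffcons x f ord0 = x.
Proof. by rewrite ffunE unlift_none. Qed.

Lemma ffconsS x f k : ffcons x f (lift ord0 k) = f k.
Proof. by rewrite ffunE liftK. Qed.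

(** Head and tail give a bijection; it drives the inductions on the number of coordinates in
    [sum_prod_paired_le] and [sum_uniform]. *)
Lemma sum_ffcons (R : nmodType) (F : {ffun 'I_K.+1 -> X} -> R) :
  \sum_f F f = \sum_x \sum_f F (ffcons x f).
Proof.
rewrite pair_bigA /= (reindex (fun p => ffcons p.1 p.2)) //=.
exists (fun f : {ffun 'I_K.+1 -> X} => (f ord0, [ffun k => f (lift ord0 k)])).
  move=> [x f] _ /=; rewrite ffcons0; congr pair.
  by apply/ffunP => k; rewrite ffunE ffconsS.
move=> f _ /=; apply/ffunP => k; rewrite ffunE.
by case: unliftP => [k'|] -> //; rewrite ffunE.
Qed.

End FunctionsOnOrdSucc.

(** These are exactly the patterns in which every value occurs an even number of times, so that a
    product of four signs is identically 1. *)
Definition paired (T : eqType) (x y z t : T) : bool :=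
  [|| (x == y) && (z == t), (x == z) && (y == t) | (x == t) && (y == z)].

(** A union bound over the three pairings gives the factor 3. For each pairing the sum factors into
    two inner products, and Cauchy-Schwarz bounds both. *)
Lemma sum_paired_le (R : rcfType) (X : finType) (a b c d : X -> R) :
  (forall x, 0 <= a x) -> (forall x, 0 <= b x) ->
  (forall x, 0 <= c x) -> (forall x, 0 <= d x) ->
  \sum_x \sum_y \sum_z \sum_t (paired x y z t)%:R * (a x * b y * c z * d t) <=
    3 * (l2norm a * l2norm b * l2norm c * l2norm d).
Proof.
move=> a0 b0 c0 d0.
have abcd x y z t : 0 <= a x * b y * c z * d t by rewrite !mulr_ge0.
have sum_eq (F : X -> R) u : \sum_v (u == v)%:R * F v = F u.
  rewrite (bigD1 u) //= eqxx mul1r big1 ?addr0 // => v; rewrite eq_sym.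
  by move=> /negPf ->; rewrite mul0r.
apply: (@le_trans _ _ (\sum_x \sum_y \sum_z \sum_t
  (((x == y) && (z == t))%:R * (a x * b y * c z * d t) +
   ((x == z) && (y == t))%:R * (a x * b y * c z * d t) +
   ((x == t) && (y == z))%:R * (a x * b y * c z * d t)))).
  do 4! [apply: ler_sum => ? _]; rewrite -!mulrDl ler_wpM2r // -!natrD ler_nat.
  by rewrite /paired; do 3! case: (_ && _).
have S (F1 F2 : X -> X -> X -> X -> R) :
    \sum_x \sum_y \sum_z \sum_t (F1 x y z t + F2 x y z t) =
    \sum_x \sum_y \sum_z \sum_t F1 x y z t +
    \sum_x \sum_y \sum_z \sum_t F2 x y z t.
  rewrite -big_split; apply: eq_bigr => x _; rewrite -big_split.
  apply: eq_bigr => y _; rewrite -big_split; apply: eq_bigr => z _.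
  by rewrite -big_split.
have CS (f g f' g' : X -> R) :
    (forall x, 0 <= f x) -> (forall x, 0 <= g x) ->
    (forall x, 0 <= f' x) -> (forall x, 0 <= g' x) ->
    \sum_x \sum_y (f x * g x) * (f' y * g' y) <=
    l2norm f * l2norm g * (l2norm f' * l2norm g').
  move=> f0 g0 f'0 g'0.
  under eq_bigr do rewrite -mulr_sumr.
  rewrite -mulr_suml ler_pM ?sum_mul_le_l2norm //.
    by apply: sumr_ge0 => i _; rewrite mulr_ge0.
  by apply: sumr_ge0 => i _; rewrite mulr_ge0.
rewrite !S; set L := l2norm a * _ * _ * _.
have -> : 3 * L = L + L + L by ring.
apply: lerD; [apply: lerD|].
- apply: le_trans (le_trans (CS a b c d a0 b0 c0 d0) _); last by rewrite /L mulrA.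
  rewrite le_eqVlt; apply/orP; left; apply/eqP; apply: eq_bigr => x _.
  under eq_bigr => y _ do under eq_bigr => z _ do
    under eq_bigr => t _ do rewrite -mulnb natrM -mulrA.
  under eq_bigr => y _ do under eq_bigr => z _ do rewrite -mulr_sumr sum_eq.
  under eq_bigr => y _ do rewrite -mulr_sumr.
  by rewrite sum_eq; apply: eq_bigr => z _; ring.
- apply: le_trans (le_trans (CS a c b d a0 c0 b0 d0) _); last first.
    by rewrite /L le_eqVlt; apply/orP; left; apply/eqP; ring.
  rewrite le_eqVlt; apply/orP; left; apply/eqP; apply: eq_bigr => x _.
  apply: eq_bigr => y _.
  under eq_bigr => z _ do
    under eq_bigr => t _ do rewrite -mulnb natrM -mulrA.
  under eq_bigr => z _ do rewrite -mulr_sumr sum_eq.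
  by rewrite sum_eq; ring.
- apply: le_trans (le_trans (CS a d b c a0 d0 b0 c0) _); last first.
    by rewrite /L le_eqVlt; apply/orP; left; apply/eqP; ring.
  rewrite le_eqVlt; apply/orP; left; apply/eqP; apply: eq_bigr => x _.
  apply: eq_bigr => y _.
  rewrite exchange_big /=.
  under eq_bigr => t _ do
    under eq_bigr => z _ do rewrite -mulnb natrM -mulrA.
  under eq_bigr => t _ do rewrite -mulr_sumr sum_eq.
  by rewrite sum_eq; ring.
Qed.

(* Induction on [K]: slicing along the first coordinate and replacing each
   function by the norms of its slices reduces to [sum_paired_le]. *)
Lemma sum_prod_paired_le (R : rcfType) (X : finType) (K : nat)
    (a b c d : {ffun 'I_K -> X} -> R) :
  (forall x, 0 <= a x) -> (forall x, 0 <= b x) ->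
  (forall x, 0 <= c x) -> (forall x, 0 <= d x) ->
  \sum_(x : {ffun 'I_K -> X}) \sum_(y : {ffun 'I_K -> X})
  \sum_(z : {ffun 'I_K -> X}) \sum_(t : {ffun 'I_K -> X})
    (\prod_k (paired (x k) (y k) (z k) (t k))%:R) * (a x * b y * c z * d t) <=
    3 ^+ K * (l2norm a * l2norm b * l2norm c * l2norm d).
Proof.
elim: K a b c d => [|K IH] a b c d a0 b0 c0 d0.
  have one (F : {ffun 'I_0 -> X} -> R) : \sum_x F x = F (ffun0 (card_ord 0)).
    rewrite (bigD1 (ffun0 (card_ord 0))) //= big1 ?addr0 // => f /eqP[].
    by apply/ffunP => -[].
  rewrite !one big_ord0 mul1r expr0 mul1r /l2norm !one.
  by rewrite !sqrtr_sqr !ger0_norm.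
(* The norm of the slice norms is the full norm, so each coordinate costs only the factor 3. *)
pose slice (f : {ffun 'I_K.+1 -> X} -> R) x := l2norm (fun g => f (ffcons x g)).
have slice_norm f : l2norm (slice f) = l2norm f.
  rewrite /l2norm; congr Num.sqrt; rewrite sum_ffcons; apply: eq_bigr => x _.
  exact: sqr_l2norm.
have E5 (F : {ffun 'I_K.+1 -> X} -> {ffun 'I_K.+1 -> X} ->
    {ffun 'I_K.+1 -> X} -> {ffun 'I_K.+1 -> X} -> R) :
    \sum_x \sum_y \sum_z \sum_t F x y z t =
    \sum_x0 \sum_y0 \sum_z0 \sum_t0 \sum_x \sum_y \sum_z \sum_t
      F (ffcons x0 x) (ffcons y0 y) (ffcons z0 z) (ffcons t0 t).
  rewrite sum_ffcons; apply: eq_bigr => x0 _.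
  transitivity (\sum_x \sum_y0 \sum_y \sum_z0 \sum_z \sum_t0 \sum_t
      F (ffcons x0 x) (ffcons y0 y) (ffcons z0 z) (ffcons t0 t)).
    apply: eq_bigr => x _; rewrite sum_ffcons; apply: eq_bigr => y0 _.
    apply: eq_bigr => y _; rewrite sum_ffcons; apply: eq_bigr => z0 _.
    by apply: eq_bigr => z _; rewrite sum_ffcons.
  rewrite exchange_big /=; apply: eq_bigr => y0 _.
  transitivity (\sum_x \sum_z0 \sum_y \sum_z \sum_t0 \sum_t
      F (ffcons x0 x) (ffcons y0 y) (ffcons z0 z) (ffcons t0 t)).
    by apply: eq_bigr => x _; rewrite exchange_big.
  rewrite exchange_big /=; apply: eq_bigr => z0 _.
  transitivity (\sum_x \sum_t0 \sum_y \sum_z \sum_t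
      F (ffcons x0 x) (ffcons y0 y) (ffcons z0 z) (ffcons t0 t)).
    apply: eq_bigr => x _.
    transitivity (\sum_y \sum_t0 \sum_z \sum_t
      F (ffcons x0 x) (ffcons y0 y) (ffcons z0 z) (ffcons t0 t)).
      by apply: eq_bigr => y _; rewrite exchange_big.
    by rewrite exchange_big.
  by rewrite exchange_big.
rewrite E5 exprSr -mulrA -(slice_norm a) -(slice_norm b) -(slice_norm c).
rewrite -(slice_norm d).
apply: le_trans (ler_wpM2l _ (@sum_paired_le _ _ (slice a) (slice b) (slice c)
  (slice d) _ _ _ _)); rewrite ?exprn_ge0 //; try by move=> x; exact: l2norm_ge0.
rewrite mulr_sumr; apply: ler_sum => x0 _.
rewrite mulr_sumr; apply: ler_sum => y0 _.
rewrite mulr_sumr; apply: ler_sum => z0 _.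
rewrite mulr_sumr; apply: ler_sum => t0 _.
rewrite mulrCA.
apply: le_trans (ler_wpM2l _ (IH (fun g => a (ffcons x0 g))
  (fun g => b (ffcons y0 g)) (fun g => c (ffcons z0 g))
  (fun g => d (ffcons t0 g)) _ _ _ _)) => //.
rewrite le_eqVlt; apply/orP; left; apply/eqP.
rewrite mulr_sumr; apply: eq_bigr => x _.
rewrite mulr_sumr; apply: eq_bigr => y _.
rewrite mulr_sumr; apply: eq_bigr => z _.
rewrite mulr_sumr; apply: eq_bigr => t _.
rewrite big_ord_recl !ffcons0 [RHS]mulrA; congr (_ * _ * _).
by apply: eq_bigr => k _; rewrite !ffconsS.
Qed.

(** * Kronecker products and Frobenius norm *)

(** The induction peels off the first block of [n2] columns; of the four cases, two put [y] and [j]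
    in different blocks and are absurd. Stating the index through its value allows any ordinal [y]
    to be plugged in. *)
Lemma trow_entry (F : fieldType) n1 (A : 'rV[F]_n1) m2 n2 (B : 'M[F]_(m2, n2))
    (k : 'I_m2) (j : 'I_n1) (l : 'I_n2) (y : 'I_(n1 * n2)) :
  (y : nat) = (j * n2 + l)%N -> character.trow A B k y = A 0 j * B k l.
Proof.
elim: n1 A j y => [|n1 IH] A j y; first by case: j.
move=> /= yE; rewrite [LHS]mxE.
case: splitP => y' y'E; case: (unliftP ord0 j) => [j'|] jE.
- have := ltn_ord y'; rewrite -y'E yE jE lift0 mulSn -addnA.
  by rewrite ltnNge leq_addr.
- have -> : y' = l by apply/val_inj; rewrite /= -y'E yE jE mul0n.
  by rewrite mxE jE mxE; congr (A _ _ * _); apply/val_inj.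
- rewrite (IH _ j'); last first.
    apply: (@addnI n2); rewrite -y'E yE jE lift0 mulSn addnA //.
  by rewrite mxE jE; congr (A _ _ * _); apply/val_inj.
- have := ltn_ord l; have : (l = n2 + y' :> nat)%N.
    by rewrite -y'E yE jE mul0n.
  by move=> ->; rewrite ltnNge leq_addr.
Qed.

Lemma tprod_entry (F : fieldType) m1 n1 (A : 'M[F]_(m1, n1)) m2 n2
    (B : 'M[F]_(m2, n2)) (i : 'I_m1) (k : 'I_m2) (j : 'I_n1) (l : 'I_n2)
    (x : 'I_(m1 * m2)) (y : 'I_(n1 * n2)) :
  (x : nat) = (i * m2 + k)%N -> (y : nat) = (j * n2 + l)%N ->
  character.tprod A B x y = A i j * B k l.
Proof.
move=> + yE; elim: m1 A i x => [|m1 IH] A i x; first by case: i.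
move=> /= xE; rewrite [LHS]mxE.
case: splitP => x' x'E; case: (unliftP ord0 i) => [i'|] iE.
- have := ltn_ord x'; rewrite -x'E xE iE lift0 mulSn -addnA.
  by rewrite ltnNge leq_addr.
- have -> : x' = k by apply/val_inj; rewrite /= -x'E xE iE mul0n.
  by rewrite (trow_entry _ _ _ yE) mxE iE; congr (A _ _ * _); apply/val_inj.
- rewrite (IH _ i'); last first.
    by apply: (@addnI m2); rewrite -x'E xE iE lift0 mulSn addnA.
  by rewrite mxE iE; congr (A _ _ * _); apply/val_inj.
- have := ltn_ord k; have : (k = m2 + x' :> nat)%N.
    by rewrite -x'E xE iE mul0n.
  by move=> ->; rewrite ltnNge leq_addr.
Qed.

Lemma ord_mul_divmod a b (x : 'I_(a * b)) :
  exists (i : 'I_a) (k : 'I_b), (x : nat) = (i * b + k)%N.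
Proof.
have ltx := ltn_ord x.
have /andP[_ b0] : (0 < a)%N && (0 < b)%N.
  by rewrite -muln_gt0 (leq_ltn_trans (leq0n x) ltx).
have ia : (x %/ b < a)%N by rewrite ltn_divLR.
exists (Ordinal ia), (Ordinal (ltn_pmod x b0)); exact: divn_eq.
Qed.

Lemma trmx_tprod (F : fieldType) m1 n1 (A : 'M[F]_(m1, n1)) m2 n2
    (B : 'M[F]_(m2, n2)) :
  (character.tprod A B)^T = character.tprod A^T B^T.
Proof.
apply/matrixP => y x; rewrite mxE.
have [i [k xE]] := ord_mul_divmod x; have [j [l yE]] := ord_mul_divmod y.
by rewrite (tprod_entry _ _ xE yE) (tprod_entry _ _ yE xE) !mxE.
Qed.

(** By the mixed-product rule [character.tprodE], the Gram matrix of a Kronecker product is the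
    Kronecker product of the Gram matrices. *)
Lemma kron_orthonormal (R : realType) s r K (A : 'I_K -> 'M[R]_(s, r)) :
  (forall k, (A k)^T *m A k = 1%:M) -> (kron A)^T *m kron A = 1%:M.
Proof.
elim: K A => [|K IH] A orthA /=; first by rewrite trmx1 mulmx1.
have cast1 m n (e : m = n) : castmx (e, e) (1%:M : 'M[R]_m) = 1%:M.
  by case: n / e.
have castmul m n m' n' (em : m = m') (en : n = n') (C : 'M[R]_(m, n)) :
    (castmx (em, en) C)^T *m castmx (em, en) C = castmx (en, en) (C^T *m C).
  by case: m' / em; case: n' / en.
rewrite castmul trmx_tprod -character.tprodE orthA IH // character.tprod1.
exact: cast1.
Qed.

(** * Frobenius norm, Pythagoras and the normal equations *)

Section Frobenius.
Variable R : realType.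

Lemma frob_ge0 m n (A : 'M[R]_(m, n)) : 0 <= frob A.
Proof. exact: sqrtr_ge0. Qed.

Lemma sqr_frob m n (A : 'M[R]_(m, n)) : frob A ^+ 2 = \sum_i \sum_j A i j ^+ 2.
Proof.
by rewrite sqr_sqrtr // !sumr_ge0 // => i _; rewrite sumr_ge0 // => j _;
  rewrite sqr_ge0.
Qed.

Lemma sqr_frob_mxtrace m n (A : 'M[R]_(m, n)) : frob A ^+ 2 = \tr (A^T *m A).
Proof.
rewrite sqr_frob exchange_big; apply: eq_bigr => j _; rewrite mxE.
by apply: eq_bigr => i _; rewrite mxE expr2.
Qed.

Lemma frob0 m n : frob (0 : 'M[R]_(m, n)) = 0.
Proof.
rewrite /frob big1 ?sqrtr0 // => i _; rewrite big1 // => j _.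
by rewrite mxE expr0n.
Qed.

Lemma frobN m n (A : 'M[R]_(m, n)) : frob (- A) = frob A.
Proof.
rewrite /frob; congr Num.sqrt.
by apply: eq_bigr => i _; apply: eq_bigr => j _; rewrite mxE sqrrN.
Qed.

Lemma sqr_frobZ m n (c : R) (A : 'M[R]_(m, n)) :
  frob (c *: A) ^+ 2 = c ^+ 2 * frob A ^+ 2.
Proof.
rewrite !sqr_frob mulr_sumr; apply: eq_bigr => i _; rewrite mulr_sumr.
by apply: eq_bigr => j _; rewrite mxE exprMn.
Qed.

Lemma frob0_eq0 m n (A : 'M[R]_(m, n)) : frob A = 0 -> A = 0.
Proof.
move=> A0; apply/matrixP => i j; rewrite mxE; apply/eqP.
have : frob A ^+ 2 = 0 by rewrite A0 expr0n.
rewrite sqr_frob pair_bigA /= => /psumr_eq0P Aij.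
have /eqP := Aij (fun p _ => sqr_ge0 (A p.1 p.2)) (i, j) isT.
by rewrite sqrf_eq0.
Qed.

Lemma mxtrace_trmul m n (A B : 'M[R]_(m, n)) :
  \tr (A^T *m B) = \sum_i \sum_j A i j * B i j.
Proof.
rewrite exchange_big; apply: eq_bigr => j _; rewrite mxE.
by apply: eq_bigr => i _; rewrite mxE.
Qed.

Lemma sqr_frobD m n (A B : 'M[R]_(m, n)) :
  frob (A + B) ^+ 2 = frob A ^+ 2 + 2 * \tr (A^T *m B) + frob B ^+ 2.
Proof.
rewrite !sqr_frob mxtrace_trmul !mulr_sumr -!big_split /=.
apply: eq_bigr => i _; rewrite !mulr_sumr -!big_split /=.
by apply: eq_bigr => j _; rewrite mxE; ring.
Qed.

Lemma ler_frobD m n (A B : 'M[R]_(m, n)) : frob (A + B) <= frob A + frob B.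
Proof.
rewrite -(@ler_pXn2r _ 2) ?nnegrE ?addr_ge0 ?frob_ge0 // sqr_frobD.
suff : \tr (A^T *m B) <= frob A * frob B by lra.
apply: le_trans (ler_norm _) _.
rewrite -(@ler_pXn2r _ 2) ?nnegrE ?mulr_ge0 ?frob_ge0 //.
rewrite real_normK ?num_real // exprMn !sqr_frob mxtrace_trmul !pair_bigA.
exact: cauchy_schwarz_sum.
Qed.

Lemma ler_frobM m n p (A : 'M[R]_(m, n)) (B : 'M[R]_(n, p)) :
  frob (A *m B) <= frob A * frob B.
Proof.
rewrite -(@ler_pXn2r _ 2) ?nnegrE ?mulr_ge0 ?frob_ge0 //.
rewrite exprMn !sqr_frob mulr_suml; apply: ler_sum => i _.
rewrite [in leRHS]exchange_big mulr_sumr; apply: ler_sum => j _.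
by rewrite mxE cauchy_schwarz_sum.
Qed.

Lemma frob_isometry m n p (P : 'M[R]_(m, n)) (X : 'M[R]_(n, p)) :
  P^T *m P = 1%:M -> frob (P *m X) = frob X.
Proof.
move=> orthP; apply/eqP; rewrite -(@eqrXn2 _ 2) ?frob_ge0 // !sqr_frob_mxtrace.
by rewrite trmx_mul mulmxA -(mulmxA X^T) orthP mulmx1.
Qed.

Lemma sqr_frob_orthonormal m n (P : 'M[R]_(m, n)) :
  P^T *m P = 1%:M -> frob P ^+ 2 = n%:R.
Proof. by move=> orthP; rewrite sqr_frob_mxtrace orthP mxtrace1. Qed.

(** The residual of the projection is orthogonal to the columns of [P], so the cross term vanishes,
    and [P] is an isometry. *)
Lemma pythagoras m n p (P : 'M[R]_(m, n)) (B : 'M[R]_(m, p))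
    (X : 'M[R]_(n, p)) :
  P^T *m P = 1%:M ->
  frob (P *m X - B) ^+ 2 =
    frob (X - P^T *m B) ^+ 2 + frob (B - P *m (P^T *m B)) ^+ 2.
Proof.
move=> orthP; rewrite -(frob_isometry (X - _) orthP) -(frobN (B - _)).
have -> : P *m X - B = P *m (X - P^T *m B) + - (B - P *m (P^T *m B)).
  by rewrite mulmxBr opprB addrA subrK.
rewrite sqr_frobD trmx_mul -mulmxA mulmxN (mulmxBr P^T) (mulmxA P^T P) orthP mul1mx.
by rewrite subrr oppr0 mulmx0 mxtrace0 mulr0 addr0.
Qed.

(** If the gradient direction [W] were nonzero, a small step against it would strictly decrease the
    residual. *)
Lemma lsq_normal_equation m p n (M : 'M[R]_(m, p)) (B : 'M[R]_(m, n))
    (X : 'M[R]_(p, n)) :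
  lsq_solution M B X -> M^T *m (M *m X) = M^T *m B.
Proof.
move=> minX; apply/eqP; rewrite -subr_eq0 -mulmxBr; set E := M *m X - B.
set W := M^T *m E; apply/eqP/frob0_eq0/eqP.
have EW : \tr (E^T *m (M *m W)) = frob W ^+ 2.
  by rewrite sqr_frob_mxtrace [in RHS]/W trmx_mul trmxK mulmxA.
(* The optimal step has denominator [frob (M *m W) ^+ 2]; the added 1 keeps it positive, and the
   decrease is still [t ^+ 2 * (f + 2)]. *)
pose t := frob W ^+ 2 / (frob (M *m W) ^+ 2 + 1).
have f0 := sqr_ge0 (frob (M *m W)).
have tf : t * (frob (M *m W) ^+ 2 + 1) = frob W ^+ 2.
  by rewrite divfK // gt_eqF // ltr_wpDl.
have t0 : 0 <= t by rewrite divr_ge0 ?sqr_ge0 // addr_ge0.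
have := minX (X + - t *: W).
rewrite -(@ler_pXn2r _ 2) ?nnegrE ?frob_ge0 // mulmxDr -scalemxAr addrAC -/E.
have -> : frob (E + - t *: (M *m W)) ^+ 2 =
    frob E ^+ 2 - 2 * t * frob W ^+ 2 + t ^+ 2 * frob (M *m W) ^+ 2.
  rewrite sqr_frobD -scalemxAr mxtraceZ EW -EW.
  by rewrite sqr_frobZ; ring.
rewrite -tf; move: f0 tf; set f := frob (M *m W) ^+ 2; set e := frob E ^+ 2.
move=> f0 tf le_quad; rewrite -sqrf_eq0; move: le_quad.
have -> : e - 2 * t * (t * (f + 1)) + t ^+ 2 * f = e - t ^+ 2 * (f + 2) by ring.
rewrite -subr_ge0 => le_quad.
have t_0 : t = 0.
  apply/eqP; rewrite -sqrf_eq0 eq_le sqr_ge0 andbT.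
  have : t ^+ 2 * (f + 2) <= 0 by lra.
  by rewrite pmulr_lle0 // ltr_wpDl.
by rewrite -tf t_0 mul0r.
Qed.

End Frobenius.

(** * k-wise independence on finite spaces *)

(** The law of a hash map as a weight on the finite set of functions: its marginals on at most [k]
    keys are uniform. Empty [J] yields total mass 1 once [V] is inhabited. *)
Definition kwise_uniform_law (R : realFieldType) (k : nat) (I V : finType)
    (mu : {ffun I -> V} -> R) : Prop :=
  (forall f, 0 <= mu f) /\
  forall (J : {set I}) (v : {ffun I -> V}), (#|J| <= k)%N ->
    \sum_(f : {ffun I -> V} | [forall i in J, f i == v i]) mu f =
    #|V|%:R ^- #|J|.

Section KwiseUniformLaw.
Variables (R : realFieldType) (I V : finType).
Implicit Types mu : {ffun I -> V} -> R.

Lemma kwise_uniform_law_sum1 k mu :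
  (0 < #|V|)%N -> kwise_uniform_law k mu -> \sum_f mu f = 1.
Proof.
case/card_gt0P => v0 _ [_ /(_ finset.set0 [ffun=> v0])]; rewrite cards0 expr0 invr1.
move=> /(_ isT) <-; apply: eq_bigl => f; apply/esym/forallP => i.
by rewrite inE.
Qed.

Lemma kwise_uniform_law_pair k mu (x y : I) (u v : V) :
  (1 < k)%N -> kwise_uniform_law k mu -> x != y ->
  \sum_(f : {ffun I -> V} | (f x == u) && (f y == v)) mu f = #|V|%:R ^- 2.
Proof.
move=> k2 [_ law] xy; have cardJ : #|[set x; y]%SET| = 2%N by rewrite cards2 xy.
rewrite -cardJ.
rewrite -(law _ [ffun z => if z == x then u else v]) ?cardJ //.
apply: eq_bigl => f; apply/andP/forall_inP => [[fx fy] z|H].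
  by rewrite !inE ffunE; case: eqP => [-> //|_ /= /eqP ->].
split.
  by have := H x; rewrite !inE eqxx ffunE eqxx => /(_ isT).
by have := H y; rewrite !inE eqxx orbT ffunE (eq_sym y x) (negPf xy) => /(_ isT).
Qed.

(** Grouping the functions by their restriction to [J] gives classes of equal mass; the sum over
    restrictions then factors into a product over [J]. *)
Lemma kwise_uniform_law_prod k mu (J : {set I}) (phi : V -> R) :
  (0 < #|V|)%N -> kwise_uniform_law k mu -> (#|J| <= k)%N ->
  \sum_f mu f * \prod_(i in J) phi (f i) =
    (#|V|%:R^-1 * \sum_v phi v) ^+ #|J|.
Proof.
move=> /card_gt0P[v0 _] [_ law] leJ.
(* The default [v0] outside [J] gives each class one representative, in the form that
   [big_distr_big] expects. *)
pose restr (f : {ffun I -> V}) := [ffun i => if i \in J then f i else v0].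
rewrite (partition_big restr (fun v => v \in pffun_on v0 (mem J) predT)) /=.
  rewrite exprMn exprVn -[X in _ * X]prodr_const.
  rewrite (big_distr_big v0) /= mulr_sumr; apply: eq_bigr => v vJ.
  rewrite -(law J v) // mulr_suml.
  apply: eq_big => [f|f /eqP fv].
    apply/eqP/forall_inP => [<- i iJ|fv]; first by rewrite ffunE iJ.
    apply/ffunP => i; rewrite ffunE; case: ifPn => [iJ|iJ]; first exact/eqP/fv.
    by have /pffun_onP[/supportP ->] := vJ.
  by congr (_ * _); apply: eq_bigr => i iJ; rewrite -fv ffunE iJ.
move=> f _; apply/pffun_onP; split=> [|i _]; last by [].
by apply/supportP => i iJ; rewrite ffunE (negPf iJ).
Qed.

End KwiseUniformLaw.

Lemma not_paired_odd (T : eqType) (x y z t : T) : ~~ paired x y z t ->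
  has (fun u => odd (count_mem u [:: x; y; z; t])) [:: x; y; z; t].
Proof.
rewrite /paired /= !eqxx (eq_sym y x) (eq_sym z x) (eq_sym t x).
rewrite (eq_sym z y) (eq_sym t y) (eq_sym t z).
case: (eqVneq x y) => xy; case: (eqVneq x z) => xz;
case: (eqVneq x t) => xt; case: (eqVneq y z) => yz;
case: (eqVneq y t) => yt; case: (eqVneq z t) => zt; subst; rewrite ?eqxx //=.
all: by match goal with H : is_true (?u != ?u) |- _ => rewrite eqxx in H end.
Qed.

(** A paired product has mean at most 1 in absolute value. Otherwise some key occurs an odd number
    of times, and an independent sign of mean zero survives. *)
Lemma fourwise_sign_mean (R : realFieldType) (I : finType)
    (nu : {ffun I -> bool} -> R) (x y z t : I) :
  kwise_uniform_law 4 nu ->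
  `|\sum_f nu f * ((-1) ^+ f x * (-1) ^+ f y * ((-1) ^+ f z * (-1) ^+ f t))|
    <= (paired x y z t)%:R.
Proof.
move=> law; case: (boolP (paired x y z t)) => [_|npair].
  have <- : \sum_f nu f = true%:R by rewrite (kwise_uniform_law_sum1 _ law) ?card_bool.
  apply: le_trans (ler_norm_sum _ _ _) _; apply: ler_sum => f _.
  rewrite !normrM !normr_sign !mulr1 ger0_norm //.
  by case: law.
pose l := [:: x; y; z; t].
(* Signs square to 1, so only keys of odd multiplicity remain; there are at most four of them. *)
pose J := [set u | odd (count_mem u l)]%SET.
have prodJ (f : {ffun I -> bool}) :
    (-1) ^+ f x * (-1) ^+ f y * ((-1) ^+ f z * (-1) ^+ f t) =
    \prod_(u in J) (-1) ^+ f u :> R.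
  transitivity (\prod_(u <- l) (-1) ^+ f u : R).
    by rewrite /l !big_cons big_nil mulr1 !mulrA.
  rewrite -prodr_undup_exp_count big_uniq ?undup_uniq //.
  rewrite big_mkcond [RHS]big_mkcond; apply: eq_bigr => u _.
  rewrite mem_undup [u \in J]inE -exprM mulnC exprM -[X in X ^+ _]signr_odd.
  case: (boolP (u \in l)) => [_|/count_memPn -> //].
  by case: odd; rewrite ?expr1 ?expr0 ?expr1n.
under eq_bigr do rewrite prodJ.
rewrite (kwise_uniform_law_prod (fun b : bool => (-1) ^+ b) _ law) ?card_bool //;
  last first.
  have : (#|l| <= 4)%N by exact: card_size.
  apply: leq_trans; apply/subset_leq_card/fintype.subsetP => u; rewrite inE.
  by case: (boolP (u \in l)) => // /count_memPn ->.
(* Each factor averages to 0, so the mean is [0 ^+ #|J|], which vanishes unless [J] is empty. *)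
rewrite big_bool /= expr0 addrC subrr mulr0 expr0n cards_eq0.
case: eqP => [J0|_]; last by rewrite normr0.
have /hasP[u ul uodd] := not_paired_odd npair.
by have := finset.in_set0 u; rewrite -J0 inE uodd.
Qed.

(** Conditioning on [f y = v] forces [f x = t + v] in the cyclic group ['I_m.+1]: there are [m.+1]
    cases, each of mass [m.+1%:R ^- 2]. *)
Lemma pairwise_uniform_difference (R : realFieldType) (m : nat) (I : finType)
    (mu : {ffun I -> 'I_m.+1} -> R) (k : nat) (x y : I) :
  (1 < k)%N -> kwise_uniform_law k mu -> x != y ->
  forall t, \sum_(f : {ffun I -> 'I_m.+1} | f x - f y == t) mu f = m.+1%:R^-1.
Proof.
move=> k2 law xy t.
rewrite (partition_big (fun f : {ffun I -> 'I_m.+1} => f y) predT) //=.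
transitivity (\sum_(v : 'I_m.+1) (m.+1%:R ^- 2 : R)); last first.
  rewrite sumr_const card_ord -[LHS]mulr_natl expr2 invfM mulrA mulfV ?mul1r //.
apply: eq_bigr => v _.
have := kwise_uniform_law_pair (t + v) v k2 law xy; rewrite card_ord => <-.
apply: eq_bigl => f; rewrite subr_eq.
by case: (eqVneq (f y) v) => [->|]; rewrite ?andbF ?andbT.
Qed.

(** A uniform element of a finite group stays uniform after translation by an independent one. The
    induction splits off coordinate 0, which either is [k0] or acts as the translation. *)
Lemma sum_uniform (R : realFieldType) (m : nat) (X : finType) (K : nat)
    (mu : 'I_K -> X -> R) (D : 'I_K -> X -> 'I_m.+1) (k0 : 'I_K) :
  (forall k, \sum_f mu k f = 1) ->
  (forall t, \sum_(f | D k0 f == t) mu k0 f = m.+1%:R^-1) ->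
  forall t, \sum_(h : {ffun 'I_K -> X} | \sum_k D k (h k) == t)
     \prod_k mu k (h k) = m.+1%:R^-1.
Proof.
elim: K mu D k0 => [|K IH] mu D k0; first by case: k0.
move=> sum1 unif t.
have prod1 : \sum_(h : {ffun 'I_K -> X}) \prod_k mu (lift ord0 k) (h k) = 1.
  by rewrite -(bigA_distr_bigA (fun k f => mu (lift ord0 k) f)) big1.
rewrite big_mkcond sum_ffcons /=.
have split_cond f h : (\sum_k D k (ffcons f h k) == t) =
    (D ord0 f + \sum_k D (lift ord0 k) (h k) == t).
  rewrite big_ord_recl ffcons0; congr (_ + _ == _).
  by apply: eq_bigr => k _; rewrite ffconsS.
have split_prod f h : \prod_k mu k (ffcons f h k) =
    mu ord0 f * \prod_k mu (lift ord0 k) (h k).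
  rewrite big_ord_recl ffcons0; congr (_ * _).
  by apply: eq_bigr => k _; rewrite ffconsS.
under eq_bigr => f _ do under eq_bigr => h _ do rewrite split_cond split_prod.
case: (unliftP ord0 k0) unif => [k1|] -> unif.
  transitivity (\sum_f m.+1%:R^-1 * mu ord0 f : R); last first.
    by rewrite -mulr_sumr sum1 mulr1.
  apply: eq_bigr => f _.
  have {}IH := IH (fun k => mu (lift ord0 k)) (fun k => D (lift ord0 k)) k1
    (fun k => sum1 _) unif (t - D ord0 f).
  rewrite [RHS]mulrC -IH mulr_sumr [RHS]big_mkcond.
  by apply: eq_bigr => h _; rewrite eq_sym addrC -subr_eq eq_sym.
transitivity (\sum_(h : {ffun 'I_K -> X})
    m.+1%:R^-1 * \prod_k mu (lift ord0 k) (h k)); last first.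
  by rewrite -mulr_sumr prod1 mulr1.
rewrite exchange_big /=; apply: eq_bigr => h _.
rewrite -(unif (t - \sum_k D (lift ord0 k) (h k))) mulr_suml [RHS]big_mkcond.
by apply: eq_bigr => f _; rewrite eq_sym -subr_eq eq_sym.
Qed.

(** * Second moment of TensorSketch *)

Definition digits s K (i : 'I_(s ^ K)) : {ffun 'I_K -> 'I_s} :=
  [ffun k => digit i k].

(** Injective by the base-[s] expansion [digitE]; both sides have [s ^ K] elements. *)
Lemma digits_bij s K : bijective (@digits s K).
Proof.
apply: inj_card_bij; last by rewrite card_ffun !card_ord.
move=> i j /ffunP eq_ij; apply/val_inj; rewrite /= !digitE.
by apply: eq_bigr => k _; have := eq_ij k; rewrite !ffunE => ->.
Qed.

(** Reading buckets in the cyclic group ['I_m.+1] turns a collision into the vanishing of a sum of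
    differences. *)
Lemma ts_bucketE K s m (h : 'I_K -> {ffun 'I_s -> 'I_m.+1}) (i : 'I_(s ^ K)) :
  ts_bucket h i = (\sum_k h k (digit i k) : 'I_m.+1)%R :> nat.
Proof.
rewrite /ts_bucket.
suff valS L (f : 'I_L -> 'I_m.+1) :
    ((\sum_k f k)%R : 'I_m.+1) = ((\sum_k f k)%N %% m.+1)%N :> nat.
  by rewrite valS.
elim: L f => [|L IH] f; first by rewrite !big_ord0 mod0n.
by rewrite !big_ord_recl /= IH modnDmr.
Qed.

(** Every index falls in exactly one bucket, so summing over the rows of the sketch leaves the
    collision indicator. *)
Lemma ts_dotE (R : realType) K s m p q (h : 'I_K -> {ffun 'I_s -> 'I_m.+1})
    (g : 'I_K -> {ffun 'I_s -> bool})
    (A : 'M[R]_(s ^ K, p)) (B : 'M[R]_(s ^ K, q)) u v :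
  ((ts_matrix R h g *m A)^T *m (ts_matrix R h g *m B)) u v =
  \sum_i \sum_j A i u * B j v * (ts_sign R g i * ts_sign R g j) *
    (ts_bucket h i == ts_bucket h j)%:R.
Proof.
have SE n (C : 'M[R]_(s ^ K, n)) l w : (ts_matrix R h g *m C) l w =
    \sum_i (l == ts_bucket h i :> nat)%:R * (ts_sign R g i * C i w).
  rewrite /ts_matrix -mulmxA mxE; apply: eq_bigr => i _.
  by rewrite mul_diag_mx !mxE.
rewrite mxE.
under eq_bigr => l _ do rewrite mxE !SE big_distrlr /=.
rewrite exchange_big; apply: eq_bigr => i _ /=.
rewrite exchange_big; apply: eq_bigr => j _ /=.
have lti : (ts_bucket h i < m.+1)%N by rewrite ltn_mod.
rewrite (bigD1 (Ordinal lti)) //= eqxx big1 => [|l].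
  by rewrite addr0 mul1r; ring.
rewrite -val_eqE /= => /negPf ->; by rewrite !mul0r.
Qed.

Lemma sqr_sum (R : comPzRingType) (I : finType) (F : I -> R) :
  (\sum_i F i) ^+ 2 = \sum_i \sum_j F i * F j.
Proof. by rewrite expr2 big_distrlr. Qed.

Section SecondMoment.
Variables (R : realType) (K s m : nat).
Variables (mu : 'I_K -> {ffun 'I_s -> 'I_m.+1} -> R).
Variables (nu : 'I_K -> {ffun 'I_s -> bool} -> R).
Hypothesis mu_law : forall k, kwise_uniform_law 3 (mu k).
Hypothesis nu_law : forall k, kwise_uniform_law 4 (nu k).

Let hashes := {ffun 'I_K -> {ffun 'I_s -> 'I_m.+1}}.
Let signs := {ffun 'I_K -> {ffun 'I_s -> bool}}.

(** Distinct indices differ in some digit [k0]; there the difference of hash values is uniform,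
    hence so is the sum of all differences. *)
Lemma collision_probability (i j : 'I_(s ^ K)) : i != j ->
  \sum_(h : hashes) (\prod_k mu k (h k)) *
    (ts_bucket h i == ts_bucket h j)%:R = m.+1%:R^-1.
Proof.
move=> ij.
have [k0 dk] : exists k, digit i k != digit j k.
  apply/existsP; apply: contraNT ij; rewrite negb_exists => /forallP eq_d.
  apply/eqP/(bij_inj (@digits_bij s K))/ffunP => k; rewrite !ffunE.
  by apply/eqP; rewrite -[_ == _]negbK eq_d.
have sum1 k : \sum_f mu k f = 1.
  by apply: kwise_uniform_law_sum1 (mu_law k); rewrite card_ord.
rewrite -(@sum_uniform R m _ K mu (fun k f => f (digit i k) - f (digit j k)) k0
  sum1 _ 0); last first.
  exact: (pairwise_uniform_difference _ (mu_law k0) dk).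
rewrite [RHS]big_mkcond; apply: eq_bigr => h _ /=.
rewrite sumrB subr_eq0 !ts_bucketE val_eqE.
by case: ifP; rewrite ?mulr1 ?mulr0.
Qed.

(** The second indicator is bounded by 1. *)
Lemma double_collision_probability (i j i' j' : 'I_(s ^ K)) : i != j ->
  `|\sum_(h : hashes) (\prod_k mu k (h k)) *
    ((ts_bucket h i == ts_bucket h j)%:R *
     (ts_bucket h i' == ts_bucket h j')%:R)| <= m.+1%:R^-1.
Proof.
have mu0 (h : hashes) : 0 <= \prod_k mu k (h k).
  by apply: prodr_ge0 => k _; case: (mu_law k).
move=> ij; rewrite -(collision_probability ij).
apply: le_trans (ler_norm_sum _ _ _) _; apply: ler_sum => h _.
rewrite ger0_norm ?mulr_ge0 // ler_wpM2l // ler_piMr //.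
by case: (_ == _).
Qed.

(** The sign maps of different coordinates are independent, so the mean is a product of means
    handled by [fourwise_sign_mean]. *)
Lemma sign_mean_le_paired (i j i' j' : 'I_(s ^ K)) :
  `|\sum_(g : signs) (\prod_k nu k (g k)) *
    ((ts_sign R g i * ts_sign R g j) * (ts_sign R g i' * ts_sign R g j'))| <=
  \prod_k (paired (digits i k) (digits j k) (digits i' k) (digits j' k))%:R.
Proof.
pose F k (f : {ffun 'I_s -> bool}) : R := nu k f *
  ((-1) ^+ f (digit i k) * (-1) ^+ f (digit j k) *
   ((-1) ^+ f (digit i' k) * (-1) ^+ f (digit j' k))).
have -> : \sum_(g : signs) (\prod_k nu k (g k)) *
    ((ts_sign R g i * ts_sign R g j) * (ts_sign R g i' * ts_sign R g j')) =
    \prod_k \sum_f F k f.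
  rewrite bigA_distr_bigA; apply: eq_bigr => g _.
  by rewrite /F /ts_sign -!big_split.
rewrite normr_prod; apply: ler_prod => k _; rewrite normr_ge0 /= !ffunE.
exact: fourwise_sign_mean.
Qed.

Lemma ts_second_moment (a b : 'I_(s ^ K) -> R) :
  \sum_(h : hashes) \sum_(g : signs)
    (\prod_k mu k (h k)) * (\prod_k nu k (g k)) *
    ((\sum_i \sum_j a i * b j * (ts_sign R g i * ts_sign R g j) *
       (ts_bucket h i == ts_bucket h j)%:R) - \sum_i a i * b i) ^+ 2 <=
  3 ^+ K / m.+1%:R * ((\sum_i a i ^+ 2) * (\sum_i b i ^+ 2)).
Proof.
pose I := 'I_(s ^ K).
pose c (p : I * I) := (p.1 != p.2)%:R * (a p.1 * b p.2).
pose S (g : signs) (p : I * I) := ts_sign R g p.1 * ts_sign R g p.2.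
pose C (h : hashes) (p : I * I) : R := (ts_bucket h p.1 == ts_bucket h p.2)%:R.
(* Each [i] collides with itself and its sign squares to 1, so the diagonal reproduces the inner
   product exactly. *)
have offdiag (h : hashes) (g : signs) :
    (\sum_i \sum_j a i * b j * (ts_sign R g i * ts_sign R g j) *
       (ts_bucket h i == ts_bucket h j)%:R) - \sum_i a i * b i =
    \sum_p c p * (S g p * C h p).
  have sign2 i : ts_sign R g i * ts_sign R g i = 1.
    rewrite /ts_sign -big_split big1 //= => k _.
    by rewrite -expr2 sqrr_sign.
  rewrite -[RHS](pair_bigA _ (fun i j => c (i, j) * (S g (i, j) * C h (i, j)))).
  rewrite -sumrB; apply: eq_bigr => i _ /=.
  rewrite (bigD1 i) //= [in RHS](bigD1 i) //= sign2 eqxx !mulr1.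
  rewrite /c eqxx !mul0r add0r addrAC subrr add0r; apply: eq_bigr => j ji.
  by rewrite /= (eq_sym i j) ji /S /C /=; ring.
(* Buckets and signs are independent: for each pair [p], [q] the mean splits into a bucket factor
   and a sign factor. *)
have expand : \sum_(h : hashes) \sum_(g : signs)
    (\prod_k mu k (h k)) * (\prod_k nu k (g k)) *
    ((\sum_i \sum_j a i * b j * (ts_sign R g i * ts_sign R g j) *
       (ts_bucket h i == ts_bucket h j)%:R) - \sum_i a i * b i) ^+ 2 =
    \sum_p \sum_q c p * c q *
      ((\sum_(h : hashes) (\prod_k mu k (h k)) * (C h p * C h q)) *
       (\sum_(g : signs) (\prod_k nu k (g k)) * (S g p * S g q))).
  transitivity (\sum_(h : hashes) \sum_(g : signs) \sum_p
      (\prod_k mu k (h k)) * (\prod_k nu k (g k)) *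
      \sum_q c p * (S g p * C h p) * (c q * (S g q * C h q))).
    apply: eq_bigr => h _; apply: eq_bigr => g _.
    by rewrite offdiag sqr_sum mulr_sumr.
  under eq_bigr => h _ do rewrite exchange_big.
  rewrite exchange_big; apply: eq_bigr => p _ /=.
  under eq_bigr => h _ do under eq_bigr => g _ do rewrite mulr_sumr.
  under eq_bigr => h _ do rewrite exchange_big.
  rewrite exchange_big; apply: eq_bigr => q _ /=.
  rewrite big_distrlr mulr_sumr; apply: eq_bigr => h _ /=.
  by rewrite mulr_sumr; apply: eq_bigr => g _; ring.
rewrite expand.
have [und digitsK undK] := @digits_bij s K.
pose Q (p q : I * I) : R := \prod_k (paired (digits p.1 k) (digits p.2 k)
  (digits q.1 k) (digits q.2 k))%:R.
apply: (@le_trans _ _ (\sum_p \sum_q m.+1%:R^-1 *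
    (Q p q * (`|a p.1| * `|b p.2| * `|a q.1| * `|b q.2|)))).
  apply: ler_sum => p _; apply: ler_sum => q _.
  apply: le_trans (ler_norm _) _; rewrite !normrM.
  (* On the diagonal [c p] is zero; off it, the collision bound applies to [p]. *)
  have [pp|pp] := eqVneq p.1 p.2.
    rewrite normr0 !mul0r !mulr_ge0 ?invr_ge0 //.
    by apply: prodr_ge0.
  have cle : `|(q.1 != q.2)%:R| * (`|a q.1| * `|b q.2|) <= `|a q.1| * `|b q.2|.
    by rewrite ler_piMl ?mulr_ge0 //; case: (_ != _); rewrite ?normr1 ?normr0.
  rewrite normr1 mul1r.
  rewrite [leRHS](_ : _ = (`|a p.1| * `|b p.2|) * (`|a q.1| * `|b q.2|) *
    (m.+1%:R^-1 * Q p q)); last by ring.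
  rewrite ler_pM ?mulr_ge0 //; first by rewrite ler_wpM2l ?mulr_ge0.
  rewrite ler_pM //; last exact: sign_mean_le_paired.
  exact: double_collision_probability.
(* Passing to multi-indices gives the sum the shape of [sum_prod_paired_le]. *)
pose al f := `|a (und f)|; pose be f := `|b (und f)|.
have norm_al (d : I -> R) : l2norm (fun f => `|d (und f)|) = l2norm d.
  rewrite /l2norm; congr Num.sqrt; rewrite [RHS](reindex und) /=.
    by apply: eq_bigr => f _; rewrite real_normK ?num_real.
  by exists (@digits s K) => ? _; rewrite ?undK ?digitsK.
have re (F : I -> R) : \sum_i F i = \sum_f F (und f).
  by rewrite (reindex und) //; exists (@digits s K) => ? _; rewrite ?undK ?digitsK.
under eq_bigr do rewrite -mulr_sumr.
rewrite -mulr_sumr [3 ^+ K / _]mulrC -mulrA ler_wpM2l ?invr_ge0 //.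
have := @sum_prod_paired_le R 'I_s K al be al be (fun=> normr_ge0 _)
  (fun=> normr_ge0 _) (fun=> normr_ge0 _) (fun=> normr_ge0 _).
rewrite /al /be !norm_al.
have -> : l2norm a * l2norm b * l2norm a * l2norm b =
    (\sum_i a i ^+ 2) * (\sum_i b i ^+ 2).
  by rewrite -!sqr_l2norm; ring.
apply: le_trans; rewrite le_eqVlt; apply/orP; left; apply/eqP.
rewrite -(pair_bigA _ (fun i j => \sum_q Q (i, j) q *
  (`|a i| * `|b j| * `|a q.1| * `|b q.2|))) /= re.
apply: eq_bigr => x _; rewrite re; apply: eq_bigr => y _.
rewrite -(pair_bigA _ (fun i j => Q (und x, und y) (i, j) *
  (`|a (und x)| * `|b (und y)| * `|a i| * `|b j|))) /= re.
apply: eq_bigr => z _; rewrite re; apply: eq_bigr => t _.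
by congr (_ * _); rewrite /Q /= !undK.
Qed.

Lemma ts_matrix_second_moment p q (A : 'M[R]_(s ^ K, p)) (B : 'M[R]_(s ^ K, q)) :
  \sum_(h : hashes) \sum_(g : signs)
    (\prod_k mu k (h k)) * (\prod_k nu k (g k)) *
    frob ((ts_matrix R h g *m A)^T *m (ts_matrix R h g *m B) - A^T *m B) ^+ 2 <=
  3 ^+ K / m.+1%:R * (frob A ^+ 2 * frob B ^+ 2).
Proof.
have -> : frob A ^+ 2 * frob B ^+ 2 =
    \sum_u \sum_v (\sum_i A i u ^+ 2) * (\sum_i B i v ^+ 2).
  rewrite !sqr_frob exchange_big mulr_suml; apply: eq_bigr => u _.
  by rewrite [in LHS]exchange_big mulr_sumr.
rewrite [leLHS](_ : _ = \sum_(h : hashes) \sum_(g : signs) \sum_u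
    (\prod_k mu k (h k)) * (\prod_k nu k (g k)) * \sum_v
    ((ts_matrix R h g *m A)^T *m (ts_matrix R h g *m B) - A^T *m B) u v ^+ 2);
  last first.
  by apply: eq_bigr => h _; apply: eq_bigr => g _; rewrite sqr_frob mulr_sumr.
under eq_bigr => h _ do rewrite exchange_big.
rewrite exchange_big mulr_sumr; apply: ler_sum => u _ /=.
under eq_bigr => h _ do under eq_bigr => g _ do rewrite mulr_sumr.
under eq_bigr => h _ do rewrite exchange_big.
rewrite exchange_big mulr_sumr; apply: ler_sum => v _ /=.
apply: le_trans (ts_second_moment (A^~ u) (B^~ v)).
rewrite le_eqVlt; apply/orP; left; apply/eqP.
apply: eq_bigr => h _; apply: eq_bigr => g _; congr (_ * _ ^+ 2).
rewrite mxE ts_dotE; congr (_ + _).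
by rewrite !mxE; congr (- _); apply: eq_bigr => i _; rewrite mxE.
Qed.

End SecondMoment.

(** * Deterministic error bound *)

Section Deterministic.
Variable R : realType.

(* [X - P^T B] satisfies the sketched normal equation with right-hand side
   [(S P)^T (S B')], [B'] the residual of [B]; a Gram matrix within [1/2] of the
   identity at most doubles norms when inverted. *)
Lemma sketched_solution_error l m p n (S : 'M[R]_(l, m)) (P : 'M[R]_(m, p))
    (B : 'M[R]_(m, n)) (X : 'M[R]_(p, n)) :
  frob ((S *m P)^T *m (S *m P) - 1%:M) ^+ 2 <= 4^-1 ->
  lsq_solution (S *m P) (S *m B) X ->
  frob (X - P^T *m B) <=
    2 * frob ((S *m P)^T *m (S *m (B - P *m (P^T *m B)))).
Proof.
move=> gram /lsq_normal_equation normal.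
set E := X - _; set W := _^T *m (S *m (B - _)).
have GE : (S *m P)^T *m (S *m P) *m E = W.
  by rewrite /E /W !mulmxBr -mulmxA normal !mulmxA.
have gram_half : frob (1%:M - (S *m P)^T *m (S *m P)) <= 2^-1.
  rewrite -frobN opprB -(@ler_pXn2r _ 2) ?nnegrE ?frob_ge0 ?invr_ge0 //.
  by apply: le_trans gram _; lra.
(* Absorption replaces inversion: the norm of [E] is at most that of [W] plus half its own. *)
have EE : E = W + (1%:M - (S *m P)^T *m (S *m P)) *m E.
  by rewrite mulmxBl mul1mx GE [RHS]addrC subrK.
move: EE gram_half; set G := 1%:M - _ => EE gram_half.
have := ler_frobD W (G *m E); rewrite -EE.
have := ler_frobM G E; have := ler_wpM2r (frob_ge0 E) gram_half; lra.
Qed.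

Lemma truncated_sketch_error l m p n r (S : 'M[R]_(l, m)) (P : 'M[R]_(m, p))
    (B : 'M[R]_(m, n)) (X Xtr Xr : 'M[R]_(p, n)) (eps : R) :
  0 < eps < 1 -> P^T *m P = 1%:M ->
  frob ((S *m P)^T *m (S *m P) - 1%:M) ^+ 2 <= 4^-1 ->
  frob ((S *m P)^T *m (S *m (B - P *m (P^T *m B)))) ^+ 2 <=
    eps ^+ 2 * frob (B - P *m (P^T *m B)) ^+ 2 ->
  (\rank Xr <= r)%N ->
  lsq_solution (S *m P) (S *m B) X -> best_rank_approx r X Xtr ->
  frob (P *m Xtr - B) ^+ 2 <= (1 + 20 * eps) * frob (P *m Xr - B) ^+ 2.
Proof.
move=> /andP[eps0 eps1] orthP gram resid rkXr lsqX [_ /(_ Xr rkXr) best].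
rewrite !(pythagoras _ _ orthP).
have := sketched_solution_error gram lsqX.
set X0 := P^T *m B in resid *; set e := frob (X - X0).
set w := frob (_ *m _) in resid *; set b := frob (B - _) in resid *.
set x := frob (Xr - X0) => ew.
have [e0 w0 b0 x0] : [/\ 0 <= e, 0 <= w, 0 <= b & 0 <= x].
  by split; exact: frob_ge0.
have wb : w <= eps * b.
  by rewrite -(@ler_pXn2r _ 2) ?nnegrE ?mulr_ge0 ?exprMn // ltW.
(* [Xr] competes in the rank-[r] approximation of [X], so [Xtr] is at distance at most [e + x] from
   [X]. *)
have trunc : frob (Xtr - X0) <= x + 2 * e.
  have le1 := ler_frobD (Xtr - X) (X - X0); rewrite addrA subrK in le1.
  have le2 := ler_frobD (X - X0) (X0 - Xr); rewrite addrA subrK in le2.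
  rewrite -(frobN (Xtr - X)) opprB -/e in le1.
  rewrite -(frobN (X0 - Xr)) opprB -/e -/x in le2.
  rewrite mulr_natl mulr2n addrA; apply: le_trans le1 _.
  by rewrite lerD2r [leRHS]addrC (le_trans best).
clearbody e w b x.
have trunc2 : frob (Xtr - X0) ^+ 2 <= (x + 4 * eps * b) ^+ 2.
  rewrite ler_pXn2r ?nnegrE ?frob_ge0 ?addr_ge0 ?mulr_ge0 //; [|exact: ltW..].
  lra.
(* In the expanded square, [8 * eps * x * b] is at most [4 * eps * (x ^+ 2 + b ^+ 2)] and
   [16 * eps ^+ 2] at most [16 * eps]; together they give the constant 20. *)
have amgm : 0 <= eps * (x - b) ^+ 2 by rewrite mulr_ge0 ?sqr_ge0 // ltW.
have eps2 : 0 <= eps * (1 - eps) * b ^+ 2.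
  by rewrite !mulr_ge0 ?sqr_ge0 ?subr_ge0 // ltW.
have epsx : 0 <= eps * x ^+ 2 by rewrite mulr_ge0 ?sqr_ge0 // ltW.
nra.
Qed.

End Deterministic.

(** * Laws of finitely-valued random variables *)

Section FiniteLaw.
Variables (R : realType) (d : measure_display) (T : measurableType d).
Variable Pr : probability T R.

Definition law (F : Type) (X : T -> F) (f : F) : R :=
  fine (Pr [set w | X w = f]).

Lemma law_ge0 (F : Type) (X : T -> F) f : 0 <= law X f.
Proof. exact: fine_ge0. Qed.

Lemma lawK (F : Type) (X : T -> F) f :
  measurable [set w | X w = f] -> Pr [set w | X w = f] = (law X f)%:E.
Proof. by move=> mX; rewrite /law fineK // fin_num_measure. Qed.

Lemma finite_preimage_law (F : finType) (X : T -> F) (P : pred F) :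
  (forall f, measurable [set w | X w = f]) ->
  Pr [set w | P (X w)] = (\sum_(f | P f) law X f)%:E.
Proof.
move=> mX; rewrite [Y in Pr Y](_ : _ =
  \bigcup_(f in [set` enum P]) [set w | X w = f]); last first.
  apply/seteqP; split=> [w Pw|w [f /=]]; last by rewrite mem_enum => Pf ->.
  by exists (X w) => //=; rewrite mem_enum.
rewrite measure_fin_bigcup //; last first.
  by move=> f g _ _ [w [<- <-]].
rewrite -fsbig_seq ?enum_uniq // big_enum /= -sumEFin.
by apply: eq_bigr => f _; rewrite lawK.
Qed.

(** The product rule is tested on singletons, whose probabilities are the uniform ones. *)
Lemma random_hash_law k (I V : finType) (h : T -> {ffun I -> V}) :
  random_hash Pr k h -> kwise_uniform_law k (law h).
Proof.
case=> mh unif indep; split=> [f|J v leJ]; first exact: law_ge0.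
apply: EFin_inj; rewrite -finite_preimage_law //.
have := indep J leJ (fun i => [set v i]).
rewrite [Y in Pr Y = _ -> _](_ : _ =
  [set w | [forall i in J, h w i == v i]]); last first.
  apply/seteqP; split=> w /=; first by move=> H; apply/forall_inP => i /H ->.
  by move=> /forall_inP H i /H/eqP.
move=> ->; under eq_bigr do rewrite [Pr _]unif.
by rewrite prodEFin prodr_const exprVn.
Qed.

Lemma independent_family_law (K s m : nat) (H : 'I_K -> T -> {ffun 'I_s -> 'I_m})
    (G : 'I_K -> T -> {ffun 'I_s -> bool})
    (h : {ffun 'I_K -> {ffun 'I_s -> 'I_m}})
    (g : {ffun 'I_K -> {ffun 'I_s -> bool}}) :
  (forall k f, measurable [set w | H k w = f]) ->
  (forall k f, measurable [set w | G k w = f]) ->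
  independent_on Pr [set: 'I_K + 'I_K]%SET (ts_family H G) ->
  law (fun w => ([ffun k => H k w], [ffun k => G k w])) (h, g) =
    (\prod_k law (H k) (h k)) * (\prod_k law (G k) (g k)).
Proof.
move=> mH mG indep.
pose A (j : 'I_K + 'I_K) : set (ts_codom s m j) :=
  match j return set (ts_codom s m j) with
  | inl k => [set h k] | inr k => [set g k] end.
have := indep A.
rewrite [Y in Pr Y = _ -> _](_ : _ =
  [set w | ([ffun k => H k w], [ffun k => G k w]) = (h, g)]); last first.
  apply/seteqP; split=> w /=.
    move=> Aw; congr pair; apply/ffunP => k; rewrite ffunE.
      exact: (Aw (inl k) (finset.in_setT _)).
    exact: (Aw (inr k) (finset.in_setT _)).
  by move=> [Eh Eg] [k|k] _; rewrite /A /= -?Eh -?Eg ffunE.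
rewrite {1}/law => ->.
transitivity (fine (\prod_j Pr (ts_family H G j @^-1` A j))%E).
  by congr fine; apply: eq_bigl => j; rewrite inE.
rewrite big_sumType /=.
under eq_bigr do rewrite [Pr _]lawK //.
under [Y in (_ * Y)%E]eq_bigr do rewrite [Pr _]lawK //.
by rewrite !prodEFin.
Qed.

End FiniteLaw.

(** Transfers the probability space to the finite set of hash tuples, where the moment bounds are
    finite weighted sums; a boolean [Q] serves as an indicator. *)
Lemma tensorsketch_law (R : realType) K s m (d : measure_display)
    (T : measurableType d) (Pr : probability T R)
    (S : T -> 'M[R]_(m.+1, s ^ K)) :
  tensorsketch Pr S ->
  exists (mu : 'I_K -> {ffun 'I_s -> 'I_m.+1} -> R)
         (nu : 'I_K -> {ffun 'I_s -> bool} -> R),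
    [/\ forall k, kwise_uniform_law 3 (mu k),
        forall k, kwise_uniform_law 4 (nu k) &
        forall Q : 'M[R]_(m.+1, s ^ K) -> bool,
          Pr [set w | Q (S w)] =
          (\sum_(h : {ffun 'I_K -> {ffun 'I_s -> 'I_m.+1}})
           \sum_(g : {ffun 'I_K -> {ffun 'I_s -> bool}})
             (\prod_k mu k (h k)) * (\prod_k nu k (g k)) *
             (Q (ts_matrix R h g))%:R)%:E].
Proof.
move=> [H [G [hashH hashG indep SE]]].
exists (fun k => law Pr (H k)), (fun k => law Pr (G k)).
split=> [k|k|Q]; [exact: random_hash_law|exact: random_hash_law|].
have mH k f : measurable [set w | H k w = f] by case: (hashH k).
have mG k f : measurable [set w | G k w = f] by case: (hashG k).
pose X w : {ffun 'I_K -> {ffun 'I_s -> 'I_m.+1}} *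
    {ffun 'I_K -> {ffun 'I_s -> bool}} := ([ffun k => H k w], [ffun k => G k w]).
have mX f : measurable [set w | X w = f].
  case: f => h g; rewrite [Y in measurable Y](_ : _ =
    (\bigcap_(k in [set: 'I_K]) [set w | H k w = h k]) `&`
    (\bigcap_(k in [set: 'I_K]) [set w | G k w = g k])).
    by apply: measurableI; apply: fin_bigcap_measurable => //;
      exact: finite_finset.
  apply/seteqP; split=> w /=.
    by case=> <- <-; split=> k _ /=; rewrite ffunE.
  by move=> [Hh Gg]; congr pair; apply/ffunP => k; rewrite ffunE;
    [exact: Hh | exact: Gg].
have SX w : S w = ts_matrix R (X w).1 (X w).2.
  by rewrite SE; congr ts_matrix; apply/funext => k; rewrite ffunE.
rewrite [Y in Pr Y](_ : _ = [set w | Q (ts_matrix R (X w).1 (X w).2)]);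
  last by apply/seteqP; split=> w /=; rewrite SX.
rewrite (finite_preimage_law Pr
  (fun p : {ffun 'I_K -> {ffun 'I_s -> 'I_m.+1}} *
     {ffun 'I_K -> {ffun 'I_s -> bool}} => Q (ts_matrix R p.1 p.2)) mX).
congr EFin; rewrite big_mkcond /= pair_bigA /=.
apply: eq_bigr => -[h g] _ /=; rewrite (independent_family_law _ _ mH mG indep).
by case: (Q _); rewrite ?mulr1 ?mulr0.
Qed.

(** * Markov's inequality and the final bound *)

Section Main.
Variables (R : realType) (K s m : nat) (d : measure_display).
Variables (T : measurableType d) (Pr : probability T R).

(** Markov's inequality for both conditions at once. Since [P^T *m C = 0], the second moment bound
    controls the sketched product of [P] and [C] itself. *)
Lemma tensorsketch_embedding p n (S : T -> 'M[R]_(m.+1, s ^ K))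
    (P : 'M[R]_(s ^ K, p)) (C : 'M[R]_(s ^ K, n)) (eps : R)
    (Q : 'M[R]_(m.+1, s ^ K) -> bool) :
  tensorsketch Pr S -> P^T *m P = 1%:M -> P^T *m C = 0 -> 0 < eps ->
  (forall M, frob ((M *m P)^T *m (M *m P) - 1%:M) ^+ 2 <= 4^-1 ->
    frob ((M *m P)^T *m (M *m C)) ^+ 2 <= eps ^+ 2 * frob C ^+ 2 -> Q M) ->
  ((1 - 3 ^+ K / m.+1%:R * (4 * p%:R ^+ 2 + p%:R / eps ^+ 2))%:E <=
   Pr [set w | Q (S w)])%E.
Proof.
move=> /tensorsketch_law[mu [nu [mu_law nu_law ->]]] orthP PC eps0 QM.
rewrite lee_fin.
pose hashes := {ffun 'I_K -> {ffun 'I_s -> 'I_m.+1}}.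
pose signs := {ffun 'I_K -> {ffun 'I_s -> bool}}.
pose wt (h : hashes) (g : signs) := (\prod_k mu k (h k)) * (\prod_k nu k (g k)).
have wt0 h g : 0 <= wt h g.
  rewrite mulr_ge0 // prodr_ge0 // => k _; first by case: (mu_law k).
  by case: (nu_law k).
have wt1 : \sum_h \sum_g wt h g = 1.
  rewrite -big_distrlr /= -(bigA_distr_bigA (fun k f => mu k f)).
  rewrite -(bigA_distr_bigA (fun k f => nu k f)) !big1 ?mulr1 // => k _.
    by rewrite (kwise_uniform_law_sum1 _ (nu_law k)) // card_bool.
  by rewrite (kwise_uniform_law_sum1 _ (mu_law k)) // card_ord.
pose F1 (h : hashes) (g : signs) := frob ((ts_matrix R h g *m P)^T *m
  (ts_matrix R h g *m P) - 1%:M) ^+ 2.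
pose F2 (h : hashes) (g : signs) := frob ((ts_matrix R h g *m P)^T *m
  (ts_matrix R h g *m C)) ^+ 2.
have E1 : \sum_h \sum_g wt h g * F1 h g <=
    3 ^+ K / m.+1%:R * (p%:R * p%:R).
  have := ts_matrix_second_moment mu_law nu_law P P.
  by rewrite (sqr_frob_orthonormal orthP) orthP.
have E2 : \sum_h \sum_g wt h g * F2 h g <=
    3 ^+ K / m.+1%:R * (p%:R * frob C ^+ 2).
  have := ts_matrix_second_moment mu_law nu_law P C.
  rewrite (sqr_frob_orthonormal orthP) PC; apply: le_trans.
  rewrite le_eqVlt; apply/orP; left; apply/eqP; apply: eq_bigr => h _.
  by apply: eq_bigr => g _; rewrite subr0.
(* If [C] is zero then [c] is 0 by the convention for inverses, and the second condition holds
   trivially. *)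
pose c := (eps ^+ 2 * frob C ^+ 2)^-1.
have c0 : 0 <= c by rewrite invr_ge0 mulr_ge0 ?sqr_ge0.
(* Where [Q] fails, [F1] exceeds [4^-1] or [F2] exceeds its threshold, so the left side is at most
   0. *)
have markov h g : 1 - 4 * F1 h g - c * F2 h g <= (Q (ts_matrix R h g))%:R.
  have F10 : 0 <= F1 h g by exact: sqr_ge0.
  have F20 : 0 <= F2 h g by exact: sqr_ge0.
  have cF2 : 0 <= c * F2 h g by rewrite mulr_ge0.
  have [Q0|nQ] := boolP (Q _); first by rewrite /=; lra.
  have [small1|big1] := lerP (F1 h g) 4^-1; last by rewrite /=; lra.
  have [small2|big2] := lerP (F2 h g) (eps ^+ 2 * frob C ^+ 2).
    by move: nQ; rewrite QM.
  have [C0|C0] := eqVneq (frob C) 0.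
    by move: big2; rewrite /F2 (frob0_eq0 C0) !mulmx0 !frob0 expr0n mulr0 ltxx.
  suff : 1 <= c * F2 h g by rewrite /=; lra.
  rewrite /c mulrC ler_pdivlMr ?mul1r ?(ltW big2) //.
  by rewrite mulr_gt0 ?exprn_gt0 // lt_def C0 frob_ge0.
apply: (@le_trans _ _ (\sum_h \sum_g wt h g * (1 - 4 * F1 h g - c * F2 h g)));
  last first.
  by apply: ler_sum => h _; apply: ler_sum => g _; rewrite ler_wpM2l.
have -> : \sum_h \sum_g wt h g * (1 - 4 * F1 h g - c * F2 h g) =
    \sum_h \sum_g wt h g - 4 * (\sum_h \sum_g wt h g * F1 h g) - c * (\sum_h \sum_g wt h g * F2 h g).
  rewrite !mulr_sumr -!sumrB; apply: eq_bigr => h _.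
  rewrite !mulr_sumr -!sumrB; apply: eq_bigr => g _.
  by ring.
rewrite wt1.
have cE2 : c * (\sum_h \sum_g wt h g * F2 h g) <=
    3 ^+ K / m.+1%:R * (p%:R / eps ^+ 2).
  apply: le_trans (ler_wpM2l c0 E2) _.
  rewrite mulrCA ler_wpM2l ?divr_ge0 ?exprn_ge0 // mulrCA ler_wpM2l //.
  rewrite /c; have [->|C0] := eqVneq (frob C ^+ 2) 0.
    by rewrite !mulr0 invr_ge0 sqr_ge0.
  by rewrite invfM divfK.
rewrite mulrDr opprD addrA; apply: lerB => //.
rewrite lerB // expr2 [leRHS]mulrCA ler_wpM2l //.
Qed.

End Main.

Theorem theorem4p1 (R : realType) :
  exists C1 C2 : R, 0 < C1 /\ 0 < C2 /\
  forall (N s r n m : nat) (eps delta : R)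
    (A : 'I_N.-1 -> 'M[R]_(s, r)) (B : 'M[R]_(s ^ N.-1, n))
    (d : measure_display) (T : measurableType d) (Pr : probability T R)
    (S : T -> 'M[R]_(m, s ^ N.-1)) (Xr : 'M[R]_(r ^ N.-1, n)),
  (2 <= N)%N -> (1 <= r)%N -> (r < s)%N -> (1 <= n)%N ->
  0 < eps < 1 -> 0 < delta < 1 ->
  (forall k, (A k)^T *m A k = 1%:M) ->
  tensorsketch Pr S ->
  C1 * (r%:R ^+ N.-1 * 3 ^+ N.-1 / delta) * (r%:R ^+ N.-1 + 1 / eps ^+ 2)
    <= m%:R ->
  rank_lsq_solution r (kron A) B Xr ->
  ((1 - delta)%:E <=
   Pr [set w | forall X Xtr : 'M[R]_(r ^ N.-1, n),
         (lsq_solution (S w *m kron A) (S w *m B) X ->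
         best_rank_approx r X Xtr ->
         frob (kron A *m Xtr - B) ^+ 2 <=
           (1 + C2 * eps) * frob (kron A *m Xr - B) ^+ 2)%R])%E.
Proof.
(* 4 is the inverse of the threshold [4^-1] for the Gram matrix, and 20 comes from
   [truncated_sketch_error]. *)
exists 4, 20; split=> //; split=> //.
move=> N s r n m eps delta A B d T Pr S Xr _ r1 _ _ epsP /andP[delta0 _] orthA.
have /andP[eps0 _] := epsP.
have p0 : 0 < r%:R ^+ N.-1 :> R by rewrite exprn_gt0 // ltr0n.
have K0 : 0 < 3 ^+ N.-1 :> R by rewrite exprn_gt0.
have ieps0 : 0 < 1 / eps ^+ 2 by rewrite divr_gt0 // exprn_gt0.
(* A sketch with no rows is excluded, because the required lower bound on its size is positive. *)
case: m S => [|m] S tsS.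
  by rewrite leNgt !(mulr_gt0, addr_gt0, invr_gt0).
move=> m_large [rkXr _].
have orthP := kron_orthonormal orthA.
pose C := B - kron A *m ((kron A)^T *m B).
have PC : (kron A)^T *m C = 0 by rewrite mulmxBr (mulmxA (kron A)^T) orthP mul1mx subrr.
pose Q (M : 'M[R]_(m.+1, s ^ N.-1)) : bool :=
  `[< forall X Xtr : 'M[R]_(r ^ N.-1, n),
         lsq_solution (M *m kron A) (M *m B) X ->
         best_rank_approx r X Xtr ->
         frob (kron A *m Xtr - B) ^+ 2 <=
           (1 + 20 * eps) * frob (kron A *m Xr - B) ^+ 2 >].
have QM M : frob ((M *m kron A)^T *m (M *m kron A) - 1%:M) ^+ 2 <= 4^-1 ->
    frob ((M *m kron A)^T *m (M *m C)) ^+ 2 <= eps ^+ 2 * frob C ^+ 2 -> Q M.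
  move=> gram resid; apply/asboolP => X Xtr.
  exact: truncated_sketch_error gram resid rkXr.
have := tensorsketch_embedding tsS orthP PC eps0 QM.
rewrite [Y in (_ <= Pr Y)%E -> _](_ : _ = [set w | forall X Xtr,
         (lsq_solution (S w *m kron A) (S w *m B) X ->
         best_rank_approx r X Xtr ->
         frob (kron A *m Xtr - B) ^+ 2 <=
           (1 + 20 * eps) * frob (kron A *m Xr - B) ^+ 2)%R]); last first.
  by apply/seteqP; split=> w /asboolP.
apply: le_trans; rewrite lee_fin lerB // natrX.
set p := r%:R ^+ N.-1 in m_large p0 *.
rewrite mulrAC ler_pdivrMr ?ltr0n //.
have : 4 * (p * 3 ^+ N.-1) * (p + 1 / eps ^+ 2) <= delta * m.+1%:R.
  rewrite [leRHS]mulrC -ler_pdivrMr //; apply: le_trans m_large.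
  by rewrite le_eqVlt; apply/orP; left; apply/eqP; ring.
apply: le_trans.
set q := 3 ^+ N.-1; rewrite mul1r; set y := (eps ^+ 2)^-1.
(* The assumed size exceeds what Markov's inequality asks for by the nonnegative last term. *)
have -> : 4 * (p * q) * (p + y) = q * (4 * p ^+ 2 + p * y) + 3 * (q * (p * y)).
  by ring.
by rewrite lerDl !mulr_ge0 ?invr_ge0 ?sqr_ge0 // ltW.
Qed.
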